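(* Let $m\ge 1$ be an integer, let $O_{m+1}$ be the Odd graph with vertex set $X=\binom{\Omega}{m}$, $|\Omega|=2m+1$, let $x\in X$, and let $\mathcal{T}=\mathcal{T}(x)$ be the Terwilliger algebra of $O_{m+1}$ with respect to $x$. Then $$\dim_{\mathbb{C}}\mathcal{T}=\binom{m+4}{4}.$$
   Context: Odd graph. $\Omega$ is a set with $|\Omega|=2m+1$, and $\binom{\Omega}{m}$ is the set of $m$-subsets of $\Omega$. The Odd graph $O_{m+1}$ has vertex set $X=\binom{\Omega}{m}$, two vertices being adjacent iff they are disjoint. It is connected with diameter $m$. Let $A\in\mathrm{Mat}_X(\mathbb{C})$ be its adjacency matrix, $\partial$ its distance function and $\Gamma_i(x)=\{y\in X: \partial(x,y)=i\}$. Terwilliger algebra. For $0\le i\le m$, $E_i^*=E_i^*(x)$ is the diagonal matrix in $\mathrm{Mat}_X(\mathbb{C})$ with $(y,y)$-entry $1$ if $y\in\Gamma_i(x)$ and $0$ otherwise. $\mathcal{T}(x)$ is the subalgebra of $\mathrm{Mat}_X(\mathbb{C})$ generated by $A,E_0^*,\dots,E_m^*$. *)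

(* Defs.v *)
From HB Require Import structures.
From mathcomp Require Import all_boot all_order all_algebra all_field.
From mathcomp Require Import complex reals.

Set Implicit Arguments.
Unset Strict Implicit.
Unset Printing Implicit Defensive.

Import GRing.Theory.
Local Open Scope ring_scope.

Definition odd_vertex (Omega : finType) (m : nat) : finType :=
  {S : {set Omega} | #|S| == m}.

Definition odd_adj (Omega : finType) (m : nat) : rel (odd_vertex Omega m) :=
  fun u v => [disjoint val u & val v].

Definition walk_of_length (V : finType) (e : rel V) (x y : V) (n : nat) : bool :=
  [exists p : n.-tuple V, path e x p && (last x p == y)].

(* The least length of a walk from x to y.  When y is reachable from x this  *)
(* length is at most #|V|.-1, so the bounded search finds it; otherwise the  *)
(* value is the out-of-range number #|V|.                                    *)
Definition gdist (V : finType) (e : rel V) (x y : V) : nat :=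
  find (walk_of_length e x y) (iota 0 #|V|).

(* 'M[F]_n carries an F-algebra (falgType) structure only when n is          *)
(* syntactically a successor, so Mat_V(F) is represented by square matrices  *)
(* of size #|V|.-1.+1, which equals #|V| because V has a base vertex x.      *)
Notation vmx F V := 'M[F]_(#|V|.-1.+1).

Lemma card_base (V : finType) (x : V) : #|V|.-1.+1 = #|V|.
Proof. by apply: prednK; apply/card_gt0P; exists x. Qed.

Definition vtx (V : finType) (x : V) (i : 'I_(#|V|.-1.+1)) : V :=
  enum_val (cast_ord (card_base x) i).

Lemma vtx_bij (V : finType) (x : V) : bijective (vtx x).
Proof.
exists (fun y => cast_ord (esym (card_base x)) (enum_rank y)) => [i|y].
  by rewrite /vtx enum_valK cast_ordK.
by rewrite /vtx cast_ordKV enum_rankK.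
Qed.

Definition adjacency_mx (F : fieldType) (V : finType) (e : rel V) (x : V) :
    vmx F V :=
  \matrix_(i, j) (e (vtx x i) (vtx x j))%:R.

Definition dual_idempotent (F : fieldType) (V : finType) (e : rel V) (x : V)
    (k : nat) : vmx F V :=
  diag_mx (\row_j (gdist e x (vtx x j) == k)%:R).

(* agenv is the unital subalgebra generated by a subspace; d is the diameter *)
(* of the graph.                                                             *)
Definition terwilliger_algebra (F : fieldType) (V : finType) (e : rel V)
    (d : nat) (x : V) : {vspace vmx F V} :=
  agenv <<adjacency_mx F e x :: [seq dual_idempotent F e x k | k <- iota 0 d.+1]>>.

(* Main.v *)
Require Import Defs.
From mathcomp Require Import all_boot all_order all_algebra all_field.
From mathcomp Require Import complex reals.
From mathcomp Require Import perm zify.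

(** The Terwilliger algebra T of the Odd graph turns out to be the full
    centraliser algebra of the stabiliser of the base vertex x in the symmetric
    group of Omega.  That centraliser has a basis indexed by the orbits of
    the stabiliser on pairs of vertices, so the dimension is an orbit count.

    Orbits.  A pair (y, z) is coloured by its two distances from x together
    with |y /\ z /\ x| and |(y /\ z) \ x|.  The distance from x is
    min (2 (m - k)) (2 k + 1) with k = |x /\ y| (gdist_radius), so the colour
    determines the sizes of all eight cells of the Venn diagram of x, y, z;
    hence two pairs of the same colour differ by a permutation of Omega that
    fixes x (colour_orbital).  Since adjacency and distance from x depend on
    colours only, T lies in the span of the colour matrices, which is closed
    under products (terwilliger_sub).

    Generation.  Conversely every colour matrix is in T (colour_mx_mem), by
    induction on m - |y /\ z|.  If y = z the colour matrix is a dual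
    idempotent.  Otherwise exchange a point of y \ z for one of z \ y, on the
    same side of x if possible; this gives w closer to z, and a common
    neighbour v of y and w.  The product E_y A E_v A N, where E_y and E_v are
    the dual idempotents of the distances of y and v and N is the colour matrix
    of (w, z), lies in T, has natural number entries, is constant on colours
    and is positive on the colour of (y, z); every other colour on which it is
    nonzero has a larger intersection, hence its matrix is already in T.  In
    characteristic 0 the colour matrix of (y, z) can be solved for
    (colour_mx_peel).  Only the support of the product matters, so no
    intersection number has to be computed.

    Counting.  For distances i and j from x and s = min i j, the two cell
    sizes range independently over intervals with s/2 + 1 (rounded down) and
    s/2 + 1 (rounded up) elements; summing over 0 <= i, j <= m gives
    C(m + 4, 4) by Pascal's rule (sum_box_size_minn). *)

Set Implicit Arguments.
Unset Strict Implicit.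
Unset Printing Implicit Defensive.

Import GRing.Theory.

(** * Algebras spanned by the colour classes of pairs *)

Section ColourAlgebra.

Local Open Scope ring_scope.

Variables (F : fieldType) (V : finType) (x : V).
Implicit Types (f g : V -> V -> nat).

(** Entries are natural numbers so that, in products, positivity of an entry is
    just the existence of a path through positive entries. *)
Definition nat_mx f : vmx F V :=
  \matrix_(i, j) (f (vtx x i) (vtx x j))%:R.

Definition nat_comp f g (y z : V) : nat := (\sum_w f y w * g w z)%N.

Lemma eq_nat_mx f g : f =2 g -> nat_mx f = nat_mx g.
Proof. by move=> fg; apply/matrixP=> i j; rewrite !mxE fg. Qed.

Lemma nat_mxM f g : nat_mx f * nat_mx g = nat_mx (nat_comp f g).
Proof.
apply/matrixP=> i j; rewrite -mulmxE !mxE natr_sum (reindex (vtx x)) /=.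
  by apply: eq_bigr => k _; rewrite !mxE natrM.
exact/onW_bij/vtx_bij.
Qed.

Lemma nat_comp_gt0 f g y z :
  (0 < nat_comp f g y z)%N <-> exists2 w, (0 < f y w)%N & (0 < g w z)%N.
Proof.
rewrite lt0n sum_nat_eq0; split.
  by case/forallPn=> w; rewrite -lt0n muln_gt0 => /andP[]; exists w.
by case=> w fw gw; apply/forallPn; exists w; rewrite -lt0n muln_gt0 fw.
Qed.

Variables (I : eqType) (c : V -> V -> I).

Definition colours : seq I := undup [seq c p.1 p.2 | p <- enum {: V * V}].

Definition colour_mx (t : I) : vmx F V := nat_mx (fun y z => c y z == t).

Definition colour_span : {vspace vmx F V} :=
  <<[seq colour_mx t | t <- colours]>>.

Definition colour_const f :=
  forall y z y' z', c y z = c y' z' -> f y z = f y' z'.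

Lemma mem_colours y z : c y z \in colours.
Proof. by rewrite mem_undup; apply/mapP; exists (y, z); rewrite ?mem_enum. Qed.

Lemma coloursP t : t \in colours -> exists y z, t = c y z.
Proof. by rewrite mem_undup => /mapP[[y z] _ ->]; exists y, z. Qed.

Lemma colour_mxE y z :
  exists i j, forall t, colour_mx t i j = (c y z == t)%:R.
Proof.
have [h _ hK] := vtx_bij x; exists (h y), (h z) => t.
by rewrite !mxE !hK.
Qed.

Lemma dim_colour_span : \dim colour_span = size colours.
Proof.
rewrite -(size_map colour_mx); apply/eqP.
rewrite -[_ == _]/(free _) -[X in free X]in_tupleE; apply/freeP=> k k0 i.
have lti : (i < size colours)%N by rewrite -(size_map colour_mx).
have [y [z tyz]] := coloursP (mem_nth (c x x) lti).
have [a [b eab]] := colour_mxE y z.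
have := congr1 (fun M : vmx F V => M a b) k0; rewrite summxE mxE => <-.
rewrite (bigD1 i) //= big1 ?addr0 => [|j jDi]; rewrite !mxE.
  by rewrite (nth_map (c x x)) // eab -tyz eqxx mulr1.
rewrite (nth_map (c x x)) -?(size_map colour_mx) // eab -tyz.
rewrite nth_uniq ?undup_uniq -?(size_map colour_mx) //.
by rewrite -[_ == _ :> nat]/(i == j) eq_sym (negPf jDi) mulr0.
Qed.

Lemma nat_mx_colours f : colour_const f ->
  exists2 phi : I -> nat, (forall y z, phi (c y z) = f y z)
    & nat_mx f = \sum_(t <- colours) (phi t)%:R *: colour_mx t.
Proof.
move=> fc.
pose phi t := if [pick p : V * V | c p.1 p.2 == t] is Some p
              then f p.1 p.2 else 0%N.
have phiE y z : phi (c y z) = f y z.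
  rewrite /phi; case: pickP => [[u v] /eqP/fc //|/(_ (y, z))].
  by rewrite eqxx.
exists phi => //; apply/matrixP=> i j; rewrite summxE !mxE.
rewrite (bigD1_seq (c (vtx x i) (vtx x j))) ?undup_uniq ?mem_colours //=.
rewrite !mxE eqxx mulr1 big1 ?addr0 ?phiE // => t /negPf tD.
by rewrite !mxE eq_sym tD mulr0.
Qed.

Lemma nat_mx_colour_span f : colour_const f -> nat_mx f \in colour_span.
Proof.
case/nat_mx_colours=> phi _ ->.
rewrite big_seq; apply: memv_suml => t tc; apply/memvZ/memv_span.
exact: map_f.
Qed.

(** The triangularity step: [f] is a combination of colour matrices with natural
    number coefficients, and all its terms but one are known to lie in [T]; in
    characteristic 0 the remaining coefficient is invertible. *)
Lemma colour_mx_peel (T : {vspace vmx F V}) f y0 z0 : [pchar F] =i pred0 ->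
    colour_const f -> nat_mx f \in T -> (0 < f y0 z0)%N ->
    (forall y z, (0 < f y z)%N -> c y z != c y0 z0 ->
       colour_mx (c y z) \in T) ->
  colour_mx (c y0 z0) \in T.
Proof.
move=> F0 fc fT f0 low; have [phi phiE fE] := nat_mx_colours fc.
move: fT; rewrite fE (bigD1_seq (c y0 z0)) ?undup_uniq ?mem_colours //=.
rewrite rpredDr.
  rewrite rpredZeq phiE ((pcharf0P F).1 F0) => /orP[/eqP f00|//].
  by rewrite f00 in f0.
rewrite big_seq_cond; apply: memv_suml => t /andP[/coloursP[y [z ->]] tD].
have [fyz|] := posnP (f y z); first by rewrite phiE fyz scale0r mem0v.
by move=> fyz; apply/memvZ/low.
Qed.

(** Colour classes are the orbits on pairs of a permutation group. *)
Hypothesis c_orbital : forall y z y' z', c y z = c y' z' ->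
  exists2 g : {perm V}, forall u v, c (g u) (g v) = c u v
                      & g y = y' /\ g z = z'.

(** Pairs of equal colour are related by a colour preserving permutation, which
    reindexes the sum over the middle vertex. *)
Lemma colour_const_comp f g :
  colour_const f -> colour_const g -> colour_const (nat_comp f g).
Proof.
move=> fc gc y z y' z' /c_orbital[s cs [<- <-]].
rewrite /nat_comp [RHS](reindex_inj (@perm_inj _ s)).
by apply: eq_bigr => w _; rewrite (fc y w (s y) (s w)) ?(gc w z (s w) (s z)).
Qed.

Lemma colour_span_mul : (colour_span * colour_span <= colour_span)%VS.
Proof.
apply/prodvP=> u v; rewrite /colour_span -[X in span X]in_tupleE.
move=> /coord_span-> /coord_span->.
rewrite mulr_suml; apply: memv_suml => i _.
rewrite mulr_sumr; apply: memv_suml => j _.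
rewrite -scalerAl -scalerAr !memvZ // !in_tupleE.
have /mapP[s _ ->] := mem_nth 0 (ltn_ord i).
have /mapP[t _ ->] := mem_nth 0 (ltn_ord j).
rewrite nat_mxM nat_mx_colour_span //.
by apply: colour_const_comp => y z y' z' ->.
Qed.

(** The diagonal being a union of colour classes puts the identity matrix in the
    span. *)
Lemma agenv_colour_span (U : {vspace vmx F V}) :
    (forall y z u, c y z = c u u -> y = z) ->
  (U <= colour_span)%VS -> (agenv U <= colour_span)%VS.
Proof.
move=> c_diag sU; apply: agenv_sub_modl; last first.
  exact: subv_trans (prodvSl _ sU) colour_span_mul.
have -> : 1%VS = <[nat_mx (fun y z => y == z)]>%VS.
  congr <[_]>%VS; apply/matrixP=> i j.
  by rewrite !mxE (inj_eq (bij_inj (vtx_bij x))).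
rewrite -memvE; apply: nat_mx_colour_span => y z y' z' e.
case: (eqVneq y z) e => [<- e|yz e].
  by rewrite (c_diag y' z' y) ?eqxx.
by case: (eqVneq y' z') e => // <- /c_diag yz'; rewrite yz' eqxx in yz.
Qed.

End ColourAlgebra.

(** * Finite sets with prescribed intersections *)

Section FiniteSets.
Variable Omega : finType.
Implicit Types (A B : {set Omega}).

Lemma exists_subset_card A (n : nat) : n <= #|A| ->
  exists2 B : {set Omega}, B \subset A & #|B| = n.
Proof.
move=> nA; exists [set u in take n (enum A)].
  by apply/subsetP=> u; rewrite inE => /mem_take; rewrite mem_enum.
rewrite cardsE (card_uniqP _) ?take_uniq ?enum_uniq // ?size_takel //.
by rewrite -cardE.
Qed.

(** The four cells cut out by [A] and [B] are disjoint, so subsets of them can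
    be chosen independently. *)
Lemma exists_prescribed_traces A B n1 n2 n3 n4 :
    n1 <= #|A :&: B| -> n2 <= #|A :\: B| -> n3 <= #|B :\: A| ->
    n4 <= #|~: (A :|: B)| ->
  exists C : {set Omega}, [/\ #|C| = n1 + n2 + n3 + n4,
    #|A :&: (B :&: C)| = n1, #|A :&: C| = n1 + n2 & #|(B :&: C) :\: A| = n3].
Proof.
move=> /exists_subset_card[C1 /subsetP s1 <-].
move=> /exists_subset_card[C2 /subsetP s2 <-].
move=> /exists_subset_card[C3 /subsetP s3 <-].
move=> /exists_subset_card[C4 /subsetP s4 <-].
have mems u : [&& (u \in C1) ==> (u \in A) && (u \in B),
                  (u \in C2) ==> (u \in A) && (u \notin B),
                  (u \in C3) ==> (u \notin A) && (u \in B)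
                & (u \in C4) ==> (u \notin A) && (u \notin B)].
  by apply/and4P; split; apply/implyP; [move/s1|move/s2|move/s3|move/s4];
    rewrite !inE ?negb_or // andbC.
have cardsU_disj (D E : {set Omega}) :
    D :&: E = set0 -> #|D :|: E| = #|D| + #|E|.
  by rewrite cardsU => ->; rewrite cards0 subn0.
exists (C1 :|: C2 :|: C3 :|: C4).
rewrite -!cardsU_disj; first split.
- by [].
- apply: eq_card => u; move: (mems u); rewrite !inE.
  by do 6?[case: (_ \in _)].
- apply: eq_card => u; move: (mems u); rewrite !inE.
  by do 6?[case: (_ \in _)].
- apply: eq_card => u; move: (mems u); rewrite !inE.
  by do 6?[case: (_ \in _)].
all: apply/setP=> u; move: (mems u); rewrite !inE; by do 6?[case: (_ \in _)].
Qed.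

(** The permutation sends the n-th point of each fibre of [c1] to the n-th point
    of the fibre of [c2] over the same colour. *)
Lemma exists_recolouring (K : eqType) (c1 c2 : Omega -> K) :
    (forall k, #|[set u | c1 u == k]| = #|[set u | c2 u == k]|) ->
  exists g : {perm Omega}, forall u, c2 (g u) = c1 u.
Proof.
move=> card12.
pose fib (c : Omega -> K) k := enum [set u | c u == k].
have size12 u : index u (fib c1 (c1 u)) < size (fib c2 (c1 u)).
  by rewrite -cardE -card12 cardE index_mem mem_enum inE.
pose g u := nth u (fib c2 (c1 u)) (index u (fib c1 (c1 u))).
have gE u : c2 (g u) = c1 u.
  by have := mem_nth u (size12 u); rewrite mem_enum inE => /eqP.
have g_inj : injective g.
  move=> u v guv; have c1uv : c1 u = c1 v by rewrite -!gE guv.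
  move: guv; rewrite /g (set_nth_default v) // -c1uv.
  move/eqP; rewrite nth_uniq ?enum_uniq // ?size12 //; last first.
    by rewrite c1uv size12.
  move=> /eqP iuv; have mu : u \in fib c1 (c1 u) by rewrite mem_enum inE.
  have mv : v \in fib c1 (c1 u) by rewrite mem_enum inE c1uv.
  by rewrite -(nth_index u mu) iuv nth_index.
by exists (perm g_inj) => u; rewrite permE.
Qed.

End FiniteSets.

(** * The counting identity *)

(** The number of pairs of cell sizes compatible with two distances of minimum
    [s]; see [colour_box]. *)
Definition box_size s := s./2.+1 * (uphalf s).+1.

Lemma box_sizeD s : box_size s + box_size s.+1 = 'C(s.+3, 2).
Proof.
have := mul_bin_left s.+3 1; rewrite bin1 /box_size /= uphalf_half.
by have := odd_double_half s; case: (odd s) => /= <-; nia.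
Qed.

Lemma sum_box_sizeD n :
  \sum_(0 <= s < n) box_size s + \sum_(0 <= s < n.+1) box_size s = 'C(n.+3, 3).
Proof.
elim: n => [|n IH]; first by rewrite big_geq // big_nat1.
rewrite big_nat_recr //= [X in _ + X]big_nat_recr //= addnACA IH box_sizeD.
by rewrite -binS.
Qed.

(** Passing from [n] to [n.+1] adds the last row and the last column, on which
    the minimum is the other index. *)
Lemma sum_box_size_minn n :
  \sum_(0 <= i < n) \sum_(0 <= j < n) box_size (minn i j) = 'C(n + 3, 4).
Proof.
elim: n => [|n IH]; first by rewrite big_geq.
rewrite big_nat_recr //=.
under eq_bigr do rewrite big_nat_recr //=.
rewrite big_split /= IH -addnA.
rewrite (@eq_big_nat _ _ _ 0 n _ box_size) => [|i ltin]; last first.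
  by rewrite (_ : minn i n = i) //; lia.
rewrite (@eq_big_nat _ _ _ 0 n.+1 _ box_size) => [|i ltin]; last first.
  by rewrite (_ : minn n i = i) //; lia.
by rewrite sum_box_sizeD !addn3 [RHS]binS.
Qed.

(** * Distances, orbits and exchanges in the Odd graph *)

(** Removing the loops of a walk leaves a simple path, so a shortest walk has
    length less than [#|V|] and is found by the bounded search. *)
Lemma gdist_shortest (V : finType) (e : rel V) (x y : V) n :
    walk_of_length e x y n -> (forall k, walk_of_length e x y k -> n <= k) ->
  gdist e x y = n.
Proof.
move=> wn n_min.
have ltnV : n < #|V|.
  case/existsP: wn => p /andP[ep /eqP]; case/shortenP: ep => q eq uq _ lq.
  have sqV : size (x :: q) <= #|V| by rewrite -(card_uniqP uq) max_card.
  apply: leq_trans sqV; rewrite ltnS; apply: n_min; apply/existsP.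
  by exists (in_tuple q); rewrite eq lq eqxx.
have hasn : has (walk_of_length e x y) (iota 0 #|V|).
  by apply/hasP; exists n; rewrite // mem_iota.
have ltf : gdist e x y < #|V| by move: hasn; rewrite has_find size_iota.
have := nth_find 0 hasn; rewrite -/(gdist e x y) nth_iota // add0n => /n_min.
rewrite leq_eqVlt => /orP[/eqP //|/(before_find 0)].
by rewrite nth_iota // wn.
Qed.

Section OddGraph.

Variables (Omega : finType) (m : nat).
Hypothesis cardOmega : #|Omega| = (2 * m + 1)%N.
Variable x : odd_vertex Omega m.
Local Notation V := (odd_vertex Omega m).
Implicit Types y z w v : V.

(** All vertices are compared with the base vertex [x] through the two sides of
    Omega, the inside and the outside of [x]. *)
Definition level y := #|val x :&: val y|.
Definition common_in y z := #|val x :&: (val y :&: val z)|.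
Definition common_out y z := #|(val y :&: val z) :\: val x|.

(** The distance from [x] of a vertex meeting it in [k] points ([gdist_radius]):
    two steps exchange one point, and an odd walk starts by passing to a vertex
    disjoint from [x]. *)
Definition radius k := minn (m - k).*2 k.*2.+1.

Lemma card_vertex y : #|val y| = m. Proof. exact/eqP/(valP y). Qed.

Lemma card_common y z : #|val y :&: val z| = common_in y z + common_out y z.
Proof. by rewrite -(cardsID (val x)) setIC. Qed.

Lemma card_out y : #|val y :\: val x| = m - level y.
Proof.
by have := cardsID (val x) (val y); rewrite card_vertex setIC -/(level y); lia.
Qed.

Lemma card_in y : #|val x :\: val y| = m - level y.
Proof.
by have := cardsID (val y) (val x); rewrite card_vertex -/(level y); lia.
Qed.

Lemma level_le y : level y <= m.
Proof. by rewrite -(card_vertex x) subset_leq_card ?subsetIl. Qed.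

Lemma card_outside y : #|~: (val x :|: val y)| = (level y).+1.
Proof.
have := cardsC (val x :|: val y); have := cardsU (val x) (val y).
rewrite !card_vertex -/(level y) cardOmega; have := level_le y; lia.
Qed.

Lemma exists_vertex y n1 n2 n3 n4 :
    n1 <= level y -> n2 <= m - level y -> n3 <= m - level y ->
    n4 <= (level y).+1 -> n1 + n2 + n3 + n4 = m ->
  exists z, [/\ level z = n1 + n2, common_in y z = n1 & common_out y z = n3].
Proof.
rewrite -card_outside -{1}card_in -card_out => h1 h2 h3 h4 hm.
have [C [cC c1 c2 c3]] := exists_prescribed_traces h1 h2 h3 h4.
have mC : #|C| == m by rewrite cC hm.
by exists (Sub C mC); rewrite /level /common_in /common_out SubK.
Qed.

Lemma odd_adjE y z :
  odd_adj y z = (common_in y z == 0) && (common_out y z == 0).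
Proof. by rewrite /odd_adj -setI_eq0 -cards_eq0 card_common addn_eq0. Qed.

(** On each side of [x] adjacent vertices are disjoint; the sides have [m] and
    [m + 1] points. *)
Lemma odd_adj_level y z : odd_adj y z ->
  level z <= m - level y /\ m - level z <= (level y).+1.
Proof.
move=> yz; rewrite -card_in -card_out -card_outside.
split; apply: subset_leq_card; apply/subsetP=> u; move/disjointFl: yz => /(_ u);
  rewrite !inE; case: (_ \in val z); rewrite ?andbF //= => ->;
  rewrite //= ?andbT //.
by rewrite orbF.
Qed.

Lemma exists_adjacent y k :
    k <= m - level y -> m - k <= (level y).+1 -> k <= m ->
  exists2 z, odd_adj y z & level z = k.
Proof.
move=> k1 k2 km.
have [|||||z [lz c1 c2]] := @exists_vertex y 0 k 0 (m - k); try lia.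
by exists z; rewrite ?odd_adjE ?c1 ?c2.
Qed.

(** The lower bound on distances: by [odd_adj_level] each step replaces the
    level [k] by [m - k] or [m - k - 1]. *)
Lemma walk_level p : path (@odd_adj Omega m) x p ->
  if odd (size p) then level (last x p) <= (size p)./2
  else m - level (last x p) <= (size p)./2.
Proof.
elim/last_ind: p => [|p y IH].
  by rewrite /= /level setIid card_vertex subnn.
rewrite rcons_path last_rcons size_rcons => /andP[/IH {}IH /odd_adj_level].
move: IH; have := level_le y; have := level_le (last x p).
by case: ifP; case: ifP; lia.
Qed.

(** The upper bound on distances: a vertex other than [x] has a neighbour whose
    [radius] is smaller by one. *)
Lemma exists_walk n y : n = radius (level y) ->
  exists2 p, path (@odd_adj Omega m) x p & last x p = y /\ size p = n.
Proof.
elim: n y => [|n IH] y; rewrite /radius => ny; have ly := level_le y.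
  have lym : level y = m by lia.
  exists [::] => //; split=> //=; apply/val_inj/eqP.
  have : val x :&: val y == val x.
    by rewrite eqEcard subsetIl card_vertex -/(level y) lym /=.
  by move/eqP/setIidPl=> xy; rewrite eqEcard xy !card_vertex leqnn.
have [z yz lz] : exists2 z, odd_adj y z & n = radius (level z).
  case on: (odd n).
    have [|||z yz lz] := @exists_adjacent y n./2; try lia.
    by exists z; rewrite // /radius lz; lia.
  have [|||z yz lz] := @exists_adjacent y (m - n./2); try lia.
  by exists z; rewrite // /radius lz; lia.
have [p xp [lp sp]] := IH z lz.
exists (rcons p y); last by rewrite last_rcons size_rcons sp.
by rewrite rcons_path xp lp /odd_adj disjoint_sym.
Qed.

Lemma gdist_radius y : gdist (@odd_adj Omega m) x y = radius (level y).
Proof.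
apply: gdist_shortest.
  have [p xp [lp /eqP sp]] := exists_walk (erefl (radius (level y))).
  by apply/existsP; exists (Tuple sp); rewrite /= xp lp eqxx.
move=> k /existsP[p /andP[/walk_level]]; rewrite size_tuple => wl /eqP lp.
by move: wl; rewrite lp /radius; have := level_le y; case: ifP; lia.
Qed.

(** The distances stand for the levels, which they determine ([radius_inj]):
    unlike the levels, they make the counting of colours uniform. *)
Definition colour y z :=
  (radius (level y), radius (level z), common_in y z, common_out y z).

Lemma radius_inj y z : radius (level y) = radius (level z) -> level y = level z.
Proof. by have := level_le y; have := level_le z; rewrite /radius; lia. Qed.

Lemma colourE y z y' z' : colour y z = colour y' z' <->
  [/\ level y = level y', level z = level z',
      common_in y z = common_in y' z' & common_out y z = common_out y' z'].
Proof.
split=> [[/radius_inj-> /radius_inj-> -> ->] //|[ly lz ci co]].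
by rewrite /colour ly lz ci co.
Qed.

Definition cell y z (b1 b2 b3 : bool) :=
  #|[set u | (u \in val x, u \in val y, u \in val z) == (b1, b2, b3)]|.

(** These equations determine the eight cells of the Venn diagram of [x], [y]
    and [z] from the colour of [(y, z)]. *)
Lemma cell_eqs y z (n := cell y z) :
  [/\ n true true true = common_in y z, n false true true = common_out y z,
      n true true true + n true true false = level y,
      n true true true + n true false true = level z
    & [/\ n true false true + n true false false = m - level y,
      n false true true + n false true false = m - level y,
      n false true true + n false false true = m - level z
    & n false false true + n false false false = (level y).+1]].
Proof.
have cellP (A : {set Omega}) b1 b2 b3 :
    (forall u, (u \in A) =
       ((u \in val x, u \in val y, u \in val z) == (b1, b2, b3))) ->
  n b1 b2 b3 = #|A|.
  by move=> An; apply: eq_card => u; rewrite inE An.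
rewrite -card_outside -!card_out /level.
split; last split.
- by apply: cellP => u; rewrite !inE; do 3!case: (_ \in _).
- by apply: cellP => u; rewrite !inE; do 3!case: (_ \in _).
- rewrite -(cardsID (val z)).
  by congr addn; apply: cellP => u; rewrite !inE; do 3!case: (_ \in _).
- rewrite -(cardsID (val y)).
  by congr addn; apply: cellP => u; rewrite !inE; do 3!case: (_ \in _).
- rewrite card_out -card_in -(cardsID (val z)).
  by congr addn; apply: cellP => u; rewrite !inE; do 3!case: (_ \in _).
- rewrite -(cardsID (val z)).
  by congr addn; apply: cellP => u; rewrite !inE; do 3!case: (_ \in _).
- rewrite -(cardsID (val y)).
  by congr addn; apply: cellP => u; rewrite !inE; do 3!case: (_ \in _).
- rewrite -(cardsID (val z)).
  by congr addn; apply: cellP => u; rewrite !inE; do 3!case: (_ \in _).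
Qed.

(** Equal colours give equal Venn diagrams, and a permutation of Omega matching
    the cells acts on the vertices. *)
Lemma colour_orbital y z y' z' : colour y z = colour y' z' ->
  exists2 g : {perm V}, forall u v, colour (g u) (g v) = colour u v
                      & g y = y' /\ g z = z'.
Proof.
case/colourE=> ly lz ci co.
have [g gE] : exists g : {perm Omega}, forall u,
    (g u \in val x, g u \in val y', g u \in val z') =
    (u \in val x, u \in val y, u \in val z).
  pose c v w u := (u \in val x, u \in val (v : V), u \in val (w : V)).
  apply: (@exists_recolouring _ _ (c y z) (c y' z')) => -[[b1 b2] b3].
  rewrite -/(cell y z b1 b2 b3) -/(cell y' z' b1 b2 b3).
  have [n1 n2 n3 n4 [n5 n6 n7 n8]] := cell_eqs y z.
  have [n1' n2' n3' n4' [n5' n6' n7' n8']] := cell_eqs y' z'.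
  by case: b1 b2 b3 => [] [] []; lia.
have memg (A : {set Omega}) u : (g u \in g @: A) = (u \in A).
  exact: mem_imset (@perm_inj _ g).
have imE (A B : {set Omega}) :
    (forall u, (g u \in B) = (u \in A)) -> g @: A = B.
  move=> AB; apply/setP=> u; rewrite -[u](permKV g).
  by rewrite memg AB.
have gx : g @: val x = val x by apply: imE => u; case: (gE u).
have gV v : #|g @: val v| == m.
  by rewrite card_imset ?card_vertex //; apply: perm_inj.
pose h v : V := Sub (g @: val v) (gV v).
have h_inj : injective h.
  move=> u v /(congr1 val); rewrite !SubK => uv.
  exact/val_inj/(imset_inj (@perm_inj _ g))/uv.
have cI (A B : {set Omega}) : g @: (A :&: B) = g @: A :&: g @: B.
  by apply: imE => u; rewrite !inE !memg.
have cD (A B : {set Omega}) : g @: (A :\: B) = g @: A :\: g @: B.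
  by apply: imE => u; rewrite !inE !memg.
have cardg (A : {set Omega}) : #|g @: A| = #|A|.
  by apply: card_imset; apply: perm_inj.
exists (perm h_inj) => [u v|].
  rewrite !permE; apply/colourE; rewrite /level /common_in /common_out !SubK.
  by rewrite -{1 3 5 7}gx -!cI -cD !cardg.
by rewrite !permE; split; apply/val_inj; rewrite SubK; apply: imE => u;
  case: (gE u).
Qed.

(** * The number of colours *)

(** The inverse of [radius] on distances. *)
Definition level_of i := if odd i then i./2 else m - i./2.

(** The cell sizes at given distances.  With levels [k] and [l], the first entry
    runs from [k + l - m] to [minn k l], the second from [m - 1 - (k + l)] to
    [minn (m - k) (m - l)].  At distance [i] from [x] the numbers
    [minn k (m - k)] and [minn (m - k) (k + 1)] are [i / 2] rounded down and up,
    so the lengths of both intervals depend on the smaller distance alone. *)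
Definition colour_box (p : nat * nat) : seq (nat * nat) :=
  [seq (a, b) | a <- iota (level_of p.1 + level_of p.2 - m)
                          (minn p.1 p.2)./2.+1,
                b <- iota (m.-1 - (level_of p.1 + level_of p.2))
                          (uphalf (minn p.1 p.2)).+1].

Definition colour_list : seq (nat * nat * nat * nat) :=
  [seq (p, q.1, q.2) | p <- [seq (i, j) | i <- iota 0 m.+1, j <- iota 0 m.+1],
                       q <- colour_box p].

Lemma size_colour_list : size colour_list = 'C(m + 4, 4).
Proof.
rewrite size_allpairs_dep sumnE big_map big_allpairs addnS -addSn.
rewrite -sum_box_size_minn /index_iota subn0.
apply: eq_bigr => i _; apply: eq_bigr => j _.
by rewrite size_allpairs !size_iota.
Qed.

Lemma uniq_colour_list : uniq colour_list.
Proof.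
apply: allpairs_uniq_dep => [|p _|].
- by apply: allpairs_uniq; rewrite ?iota_uniq // => -[? ?] [? ?].
- by apply: allpairs_uniq; rewrite ?iota_uniq // => -[? ?] [? ?].
by move=> [p [a b]] [q [c d]] _ _ /= [-> -> ->].
Qed.

Lemma mem_colour_list : colours colour =i colour_list.
Proof.
move=> [[[i j] a] b]; apply/idP/idP.
  case/coloursP=> y [z [-> -> -> ->]].
  apply/allpairsPdep; exists (radius (level y), radius (level z)).
  exists (common_in y z, common_out y z).
  have ly := level_le y; have lz := level_le z.
  have [n1 n2 n3 n4 [n5 n6 n7 n8]] := cell_eqs y z.
  split=> //.
    by apply: allpairs_f; rewrite mem_iota /radius; lia.
  by apply: allpairs_f; rewrite mem_iota /= /level_of /radius;
    do 2!case: ifP; lia.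
case/allpairsPdep=> -[i' j'] [[a' b'] [/allpairsP[[i'' j''] [ii jj]]]].
move: ii jj; rewrite !mem_iota => ii jj [-> ->] /allpairsP[[a'' b''] [aa bb]].
move: aa bb; rewrite !mem_iota /= => aa bb [-> ->] [-> -> -> ->].
move=> {i j a b i' j' a' b'}.
move: i'' j'' a'' b'' ii jj aa bb => i j a b /= im jm ab bb.
have lx : level x = m by rewrite /level setIid card_vertex.
have ki : level_of i <= m by rewrite /level_of; case: ifP; lia.
have kj : level_of j <= m by rewrite /level_of; case: ifP; lia.
have ri : radius (level_of i) = i by rewrite /level_of /radius; case: ifP; lia.
have rj : radius (level_of j) = j by rewrite /level_of /radius; case: ifP; lia.
have [|||||y [ly _ _]] :=
  @exists_vertex x (level_of i) 0 0 (m - level_of i); try lia.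
rewrite addn0 in ly.
have [|||||z [lz ci co]] := @exists_vertex y a
  (level_of j - a) b (m - level_of j - b).
- by move: ab; rewrite ly /level_of; do 2!case: ifP; lia.
- by move: ab; rewrite ly /level_of; do 2!case: ifP; lia.
- by move: bb; rewrite ly /level_of; do 2!case: ifP; lia.
- by move: bb; rewrite ly /level_of; do 2!case: ifP; lia.
- by move: ab bb; rewrite /level_of; do 2!case: ifP; lia.
have := mem_colours colour y z.
rewrite /colour ly ri ci co lz subnKC ?rj //.
by move: ab; rewrite /level_of; do 2!case: ifP; lia.
Qed.

Lemma size_colours : size (colours colour) = 'C(m + 4, 4).
Proof.
rewrite -size_colour_list; apply: perm_size; apply: uniq_perm.
- exact: undup_uniq.
- exact: uniq_colour_list.
exact: mem_colour_list.
Qed.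

(** * Exchange steps and common neighbours *)

Lemma card_setI_exchange (A B : {set Omega}) p u : p \in B -> u \notin B ->
  #|A :&: (u |: B :\ p)| + (p \in A) = #|A :&: B| + (u \in A).
Proof.
move=> pB uB.
have eqD : (A :&: (u |: B :\ p)) :\ u = (A :&: B) :\ p.
  apply/setP=> t; rewrite !inE.
  by have [->|] := eqVneq t u; rewrite ?(negPf uB) ?andbF //= andbCA.
rewrite (cardsD1 p (A :&: B)) (cardsD1 u (A :&: _)) eqD !inE eqxx pB /=.
by lia.
Qed.

(** The vertex [w] is [y] with [p] exchanged for [u].  The union of [y] and [w]
    has [m + 1] points, so its complement is a vertex [v] adjacent to both. *)
Lemma exists_exchange y z p u :
    p \in val y -> p \notin val z -> u \in val z -> u \notin val y ->
  exists v w, [/\ odd_adj y v, odd_adj v w,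
    level v + (u \in val x) = m - level y,
    level w + (p \in val x) = level y + (u \in val x)
  & common_in w z = common_in y z + (u \in val x) /\
    common_out w z = common_out y z + (u \notin val x)].
Proof.
move=> py pz uz uy; pose W := u |: (val y :\ p); pose N := ~: (u |: val y).
have cW : #|W| == m.
  have := card_setI_exchange setT py uy; rewrite !setTI !inE card_vertex.
  by move/addIn->.
have cN : #|N| == m.
  have := cardsC (u |: val y); rewrite cardsU1 uy card_vertex cardOmega -/N.
  by lia.
exists (Sub N cN : V), (Sub W cW : V); rewrite /odd_adj /level !SubK; split.
- rewrite -setI_eq0; apply/eqP/setP=> t; rewrite !inE.
  by case: (t \in val y); rewrite ?orbT.
- rewrite -setI_eq0; apply/eqP/setP=> t; rewrite !inE.
  by case: (t \in val y); rewrite ?andbF ?orbF ?orbT //= andNb.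
- have := cardsD1 u (val x :\: val y); rewrite card_in !inE uy => ->.
  rewrite addnC; congr (_ + #|pred_of_set _|); apply/setP=> t.
  by rewrite !inE negb_or andbC andbA.
- exact: card_setI_exchange.
rewrite /common_in /common_out !SubK; split.
  have := card_setI_exchange (val x :&: val z) py uy.
  by rewrite !inE uz (negPf pz) andbF addn0 andbT -!setIA ![val z :&: _]setIC.
have := card_setI_exchange (val z :\: val x) py uy.
rewrite !inE uz (negPf pz) andbF addn0 andbT => e.
by rewrite ![_ :&: val z]setIC -!setIDAC e.
Qed.

(** Both [y] and [w] lie in the complement of [v], which has [m + 1] points, so
    all but at most one point of [w] belong to [y]. *)
Lemma card_common_adj2 y v w z : odd_adj y v -> odd_adj v w ->
  common_in w z + common_out w z <= (common_in y z + common_out y z).+1.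
Proof.
move=> yv vw; rewrite -!card_common.
have c1 : #|~: val v :\: val y| = 1.
  have := cardsID (val y) (~: val v); have := cardsC (val v).
  have /setIidPr-> : val y \subset ~: val v by rewrite -disjoints_subset.
  by rewrite !card_vertex cardOmega; lia.
rewrite -addn1 -c1; apply: leq_trans (leq_card_setU _ _).
apply/subset_leq_card/subsetP=> t; rewrite !inE => /andP[tw ->].
by rewrite (disjointFl vw tw); case: (t \in val y).
Qed.

(** Inside [x] the level of [v] leaves no room: [y] fills the complement of
    [v]. *)
Lemma trace_in_adj y v : odd_adj y v -> level v = m - level y ->
  val x :&: val y = val x :\: val v.
Proof.
move=> yv lv; apply/eqP.
rewrite eqEcard card_in lv subKn ?level_le // leqnn andbT.
by apply/subsetP=> t; rewrite !inE => /andP[-> /(disjointFr yv)->].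
Qed.

(** The same phenomenon outside [x], which has [m + 1] points. *)
Lemma trace_out_adj y v : odd_adj y v -> (level v).+1 = m - level y ->
  val y :\: val x = ~: (val x :|: val v).
Proof.
move=> yv lv; apply/eqP; rewrite eqEcard card_outside card_out lv leqnn andbT.
by apply/subsetP=> t; rewrite !inE => /andP[/negPf-> /(disjointFr yv)->].
Qed.

Lemma common_in_adj2 y v w z : odd_adj y v -> odd_adj v w ->
    level v = m - level y -> level w = level y ->
  common_in y z = common_in w z.
Proof.
rewrite /odd_adj [[disjoint val v & _]]disjoint_sym => yv wv lv lw.
rewrite /common_in !setIA (trace_in_adj yv lv) (trace_in_adj wv) //.
by rewrite lw.
Qed.

Lemma common_out_adj2 y v w z : odd_adj y v -> odd_adj v w ->
    (level v).+1 = m - level y -> level w = level y ->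
  common_out y z = common_out w z.
Proof.
rewrite /odd_adj [[disjoint val v & _]]disjoint_sym => yv wv lv lw.
rewrite /common_out -!setIDAC (trace_out_adj yv lv) (trace_out_adj wv) //.
by rewrite lw.
Qed.

Lemma common_le y z :
  [/\ common_in y z <= level y, common_in y z <= level z,
      common_out y z <= m - level y & common_out y z <= m - level z].
Proof.
have [<- <- <- <- [_ <- <- _]] := cell_eqs y z.
by split; apply: leq_addr.
Qed.

(** If neither side of [x] allows an exchange within itself, then on each side
    one of the traces of [y] and [z] contains the other, and both cell sizes are
    maximal. *)
Lemma exists_exchange_pair y z : y != z ->
  exists p u, [/\ p \in val y, p \notin val z, u \in val z, u \notin val y &
    (p \in val x) = (u \in val x) \/
    common_in y z = minn (level y) (level z) /\
    common_out y z = minn (m - level y) (m - level z)].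
Proof.
move=> yz.
have pick (A B : {set Omega}) :
    #|A :&: B| < #|A| -> exists2 t, t \in A & t \notin B.
  rewrite -(cardsID B A) -[X in X < _]addn0 ltn_add2l => /card_gt0P[t].
  by rewrite !inE => /andP[? ?]; exists t.
have lyE := card_out y; have lzE := card_out z.
have [ci|ci] := ltnP (common_in y z) (minn (level y) (level z)).
  have [|p] := pick (val x :&: val y) (val z).
    by rewrite -setIA -/(common_in y z) -/(level y); lia.
  have [|u] := pick (val x :&: val z) (val y).
    by rewrite -setIA [val z :&: _]setIC -/(common_in y z) -/(level z); lia.
  rewrite !inE => /andP[ux uz] uy /andP[px py] pz.
  by exists p, u; split=> //; left; rewrite ux px.
have [co|co] := ltnP (common_out y z) (minn (m - level y) (m - level z)).
  have [|p] := pick (val y :\: val x) (val z).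
    by rewrite setIDAC -/(common_out y z) lyE; lia.
  have [|u] := pick (val z :\: val x) (val y).
    by rewrite setIDAC [val z :&: _]setIC -/(common_out y z) lzE; lia.
  rewrite !inE => /andP[ux uz] uy /andP[px py] pz.
  by exists p, u; split=> //; left; rewrite (negPf ux) (negPf px).
have [p py pz] : exists2 p, p \in val y & p \notin val z.
  apply/subsetPn; apply: contra yz => syz; apply/eqP/val_inj/eqP.
  by rewrite eqEcard syz !card_vertex leqnn.
have [u uz uy] : exists2 u, u \in val z & u \notin val y.
  apply/subsetPn; apply: contra yz => syz.
  rewrite eq_sym; apply/eqP/val_inj/eqP.
  by rewrite eqEcard syz !card_vertex leqnn.
exists p, u; split=> //; right.
have [n1 n2 n3 n4 [n5 n6 n7 n8]] := cell_eqs y z.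
by split; lia.
Qed.

Lemma eq_vertexE y z : (y == z) = (common_in y z + common_out y z == m).
Proof.
rewrite -card_common; apply/eqP/eqP=> [->|yz].
  by rewrite setIid card_vertex.
have s1 : val y :&: val z == val y.
  by rewrite eqEcard subsetIl card_vertex yz /=.
have s2 : val y :&: val z == val z.
  by rewrite eqEcard subsetIr card_vertex yz /=.
by apply: val_inj; rewrite -[LHS](eqP s1) (eqP s2).
Qed.

End OddGraph.

(** * The Terwilliger algebra of the Odd graph *)

Section Terwilliger.
Variables (F : fieldType) (Omega : finType) (m : nat).
Hypothesis cardOmega : #|Omega| = (2 * m + 1)%N.
Variable x : odd_vertex Omega m.
Local Notation V := (odd_vertex Omega m).
Local Notation T := (terwilliger_algebra F (@odd_adj Omega m) m x).
Implicit Types y z w v : V.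

Definition at_distance i y z : nat := (y == z) && (radius m (level x y) == i).

Lemma adjacency_nat_mx :
  adjacency_mx F (@odd_adj Omega m) x = nat_mx F x (fun y z : V => odd_adj y z).
Proof. by []. Qed.

Lemma dual_idempotent_nat_mx i :
  dual_idempotent F (@odd_adj Omega m) x i = nat_mx F x (at_distance i).
Proof.
apply/matrixP=> a b; rewrite !mxE gdist_radius // /at_distance.
rewrite (inj_eq (bij_inj (vtx_bij x))).
by case: (eqVneq a b) => [->|_] /=; rewrite ?mulr1n ?mulr0n.
Qed.

Lemma colour_const_adj : colour_const (colour x) (fun y z : V => odd_adj y z).
Proof.
move=> y z y' z' /(colourE cardOmega)[_ _ ci co].
by rewrite !(odd_adjE x) ci co.
Qed.

Lemma colour_const_at_distance i : colour_const (colour x) (at_distance i).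
Proof.
move=> y z y' z' /(colourE cardOmega)[ly _ ci co].
by rewrite /at_distance !(eq_vertexE x) ci co ly.
Qed.

(** Adjacency and distance from [x] can be read off the colour. *)
Lemma terwilliger_sub : (T <= colour_span F x (colour x))%VS.
Proof.
apply: agenv_colour_span; first exact: colour_orbital.
  move=> y z u /(colourE cardOmega)[_ _ ci co].
  by apply/eqP; rewrite (eq_vertexE x) ci co -eq_vertexE.
apply/span_subvP=> M; rewrite inE => /predU1P[->|/mapP[i _ ->]].
  rewrite adjacency_nat_mx.
  exact: (nat_mx_colour_span _ _ colour_const_adj).
rewrite dual_idempotent_nat_mx.
exact: (nat_mx_colour_span _ _ (@colour_const_at_distance i)).
Qed.

Lemma adj_mem : nat_mx F x (fun y z : V => odd_adj y z) \in T.
Proof.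
by apply/(subvP (sub_agenv _))/memv_span; rewrite mem_head.
Qed.

Lemma at_distance_mem i : i <= m -> nat_mx F x (at_distance i) \in T.
Proof.
move=> im; rewrite -dual_idempotent_nat_mx.
apply/(subvP (sub_agenv _))/memv_span; rewrite inE; apply/orP; right.
by apply: map_f; rewrite mem_iota.
Qed.

Lemma nat_comp_mem f g : nat_mx F x f \in T -> nat_mx F x g \in T ->
  nat_mx F x (nat_comp f g) \in T.
Proof.
by move=> fT gT; rewrite -nat_mxM /terwilliger_algebra -agenvM memv_mul.
Qed.

Lemma colour_mx_diag y : colour_mx F x (colour x) (colour x y y) \in T.
Proof.
have -> : colour_mx F x (colour x) (colour x y y) =
          nat_mx F x (at_distance (radius m (level x y))).
  apply: eq_nat_mx => u v; rewrite /at_distance; congr nat_of_bool.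
  apply/eqP/andP=> [/(colourE cardOmega)[-> _ ci co]|[/eqP<- /eqP]].
    by rewrite (eq_vertexE x) ci co -eq_vertexE.
  move/(radius_inj cardOmega) => luy; apply/(colourE cardOmega).
  have cuE w : common_in x w w = level x w by rewrite /common_in setIid.
  have := eq_vertexE x u u; have := eq_vertexE x y y; rewrite !eqxx !cuE.
  by move=> /esym/eqP e1 /esym/eqP e2; split=> //; lia.
apply: at_distance_mem; rewrite /radius; have := level_le x y; lia.
Qed.

Hypothesis F0 : [pchar F]%R =i pred0.

(** A two-step walk from [y] to [w] followed by the colour [t].  Prescribing the
    distances of [y] and of the middle vertex is what separates the exchanges
    inside [x], outside [x] and across. *)
Definition word i j t : V -> V -> nat :=
  nat_comp (at_distance i) (nat_comp (fun y z => odd_adj y z)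
    (nat_comp (at_distance j) (nat_comp (fun y z => odd_adj y z)
      (fun y z => colour x y z == t)))).

Lemma word_gt0 i j t y z : 0 < word i j t y z <->
  exists v w, [/\ radius m (level x y) = i, odd_adj y v,
    radius m (level x v) = j, odd_adj v w & colour x w z = t].
Proof.
split.
  case/nat_comp_gt0=> y1; rewrite lt0b => /andP[/eqP<- /eqP yi].
  case/nat_comp_gt0=> v; rewrite lt0b => yv.
  case/nat_comp_gt0=> v1; rewrite lt0b => /andP[/eqP<- /eqP vj].
  case/nat_comp_gt0=> w; rewrite !lt0b => vw /eqP wz.
  by exists v, w.
case=> v [w [yi yv vj vw wz]].
apply/nat_comp_gt0; exists y; first by rewrite /at_distance yi !eqxx.
apply/nat_comp_gt0; exists v; first by rewrite yv.
apply/nat_comp_gt0; exists v; first by rewrite /at_distance vj !eqxx.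
by apply/nat_comp_gt0; exists w; rewrite ?vw // wz eqxx.
Qed.

(** The induction on the size of [z] minus [y].  A vertex pair on which the word
    is positive has at least the intersection size of [(y0, z0)]; if it has the
    same size, it has the same colour: for an exchange on one side of [x]
    because the traces on the other side are unchanged, and for an exchange
    across [x] because both cell sizes are already maximal. *)
Lemma colour_mx_mem y z : colour_mx F x (colour x) (colour x y z) \in T.
Proof.
have [n] := ubnP (m - (common_in x y z + common_out x y z)).
elim: n y z => // n IH y0 z0 ltn.
have [<-|yz] := eqVneq y0 z0; first exact: colour_mx_diag.
have [p [u [py pz uz uy good]]] := exists_exchange_pair cardOmega x yz.
have [v0 [w0 [yv vw lv lw [ci co]]]] := exists_exchange cardOmega x py pz uz uy.
have tm y z : common_in x y z + common_out x y z <= m.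
  by rewrite -card_common -[leqRHS](card_vertex y) subset_leq_card ?subsetIl.
have rm y : radius m (level x y) <= m.
  by rewrite /radius; have := level_le x y; lia.
have cw : common_in x w0 z0 + common_out x w0 z0 =
          (common_in x y0 z0 + common_out x y0 z0).+1.
  by rewrite ci co addnACA -addn1; case: (u \in val x).
pose f := word (radius m (level x y0)) (radius m (level x v0)) (colour x w0 z0).
have fc : colour_const (colour x) f.
  have cc := colour_const_comp (@colour_orbital _ _ cardOmega x).
  have cd i := @colour_const_at_distance i.
  do 2![apply: (cc) (cd _) _; apply: (cc) colour_const_adj _].
  by move=> y z y' z' ->.
apply: (colour_mx_peel F0 fc).
- apply: nat_comp_mem (at_distance_mem (rm y0)) _.
  apply: nat_comp_mem adj_mem _.
  apply: nat_comp_mem (at_distance_mem (rm v0)) _.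
  apply: nat_comp_mem adj_mem _.
  apply: IH; move: ltn (tm w0 z0); rewrite cw; clear; lia.
- by apply/word_gt0; exists v0, w0.
move=> y z /word_gt0[v [w [/(radius_inj cardOmega) ly yv' rv vw']]].
have lv' := radius_inj cardOmega rv.
move=> /(colourE cardOmega)[lw' lz ci' co'] neq.
apply: IH; apply: contraR neq => far.
have := card_common_adj2 cardOmega x z yv' vw'.
rewrite ci' co' cw ltnS => close.
have sum_eq : common_in x y z + common_out x y z =
              common_in x y0 z0 + common_out x y0 z0.
  by apply/eqP; rewrite eqn_leq close; move: ltn far (tm y z); clear; lia.
suff [ci0 co0] : common_in x y z = common_in x y0 z0 /\
                 common_out x y z = common_out x y0 z0.
  exact/eqP/(colourE cardOmega).
case: good => [pu|[ci0 co0]]; last first.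
  have [] := common_le cardOmega x y z; rewrite ly lz.
  by move: sum_eq; rewrite ci0 co0; clear; lia.
have lw0 : level x w0 = level x y0.
  by apply/(@addIn (u \in val x)); rewrite -{1}pu.
have lwy : level x w = level x y by rewrite lw' ly.
(* An exchange inside x fixes the traces outside x, and conversely. *)
case ux: (u \in val x); rewrite ux /= ?addn0 ?addn1 in lv co ci.
  have := common_out_adj2 cardOmega z yv' vw' _ lwy.
  rewrite lv' ly lv co' co => /(_ erefl) co0.
  by split=> //; move: sum_eq; rewrite co0 => /addIn.
have := common_in_adj2 cardOmega z yv' vw' _ lwy.
rewrite lv' ly lv ci' ci => /(_ erefl) ci0.
by split=> //; move: sum_eq; rewrite ci0 => /addnI.
Qed.

Lemma dim_terwilliger_odd : \dim T = 'C(m + 4, 4).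
Proof.
rewrite -(size_colours cardOmega x) -(dim_colour_span F x); congr (\dim _).
apply/subv_anti; rewrite terwilliger_sub; apply/span_subvP=> M /mapP[t tc ->].
by case/coloursP: tc => y [z ->]; apply: colour_mx_mem.
Qed.

End Terwilliger.

Local Open Scope ring_scope.
Local Open Scope complex_scope.

Theorem corollary3p7 (R : realType) (m : nat) (hm : (1 <= m)%N)
    (Omega : finType) (hOmega : #|Omega| = (2 * m + 1)%N)
    (x : odd_vertex Omega m) :
  \dim (terwilliger_algebra R[i] (@odd_adj Omega m) m x) = 'C(m + 4, 4)%N.
Proof. exact/dim_terwilliger_odd/Num.Theory.pchar_num. Qed.
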